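(* Let $X$ be a finite-dimensional (real or complex) Banach space. Then $X$ has the Bishop-Phelps-Bollobás property for numerical radius.
   Context: For a real or complex Banach space $X$ with dual $X^*$ and unit sphere $S_X$, $\mathcal{L}(X)$ is the space of bounded linear operators on $X$ with the operator norm, $\Pi(X)=\{(x,x^* )\in S_X\times S_{X^*} : x^*(x)=1\}$, and the numerical radius of $T\in\mathcal{L}(X)$ is $v(T)=\sup\{|x^*(Tx)| : (x,x^* )\in\Pi(X)\}$. $X$ has the Bishop-Phelps-Bollobás property for numerical radius (BPBp-nu) if for every $0<\varepsilon<1$ there exists $\eta(\varepsilon)>0$ such that whenever $T\in\mathcal{L}(X)$ and $(x,x^* )\in\Pi(X)$ satisfy $v(T)=1$ and $|x^*(Tx)|>1-\eta(\varepsilon)$, there exist $S\in\mathcal{L}(X)$ and $(y,y^* )\in\Pi(X)$ with $v(S)=|y^*(Sy)|=1$, $\|T-S\|<\varepsilon$, $\|x-y\|<\varepsilon$ and $\|x^*-y^*\|<\varepsilon$. *)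

(* Defs.v *)
From HB Require Import structures.
From mathcomp Require Import all_boot all_order all_algebra.
From mathcomp Require Import complex.
From mathcomp Require Import all_classical all_reals all_analysis.

Set Implicit Arguments.
Unset Strict Implicit.
Unset Printing Implicit Defensive.

Import Order.TTheory GRing.Theory Num.Theory.
Import numFieldNormedType.Exports.

Local Open Scope classical_set_scope.
Local Open Scope ring_scope.

(* The scalar field K stands for R or R[i], with R : realType; norms take
   their values in K. In R[i], [x <= y] means that ['Im x = 'Im y] and
   ['Re x <= 'Re y]: [0 < e] forces e to be real, and the least upper bound of
   a nonempty set of nonnegative elements is its usual real supremum. For
   K = R, [supremum 0] is [sup]. *)
Section numerical_radius.
Variable K : numFieldType.

(* This is [Vector.axiom n X] for some n, as a proposition. *)
Definition finite_dimensional (X : lmodType K) : Prop :=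
  exists (n : nat) (v2r : X -> 'rV[K]_n), linear v2r /\ bijective v2r.

Definition bounded_operator (X Y : normedModType K) : set {linear X -> Y} :=
  [set T | bounded_near T (nbhs (0 : X))].

(* On plain functions, so that it applies to [T \- S]. *)
Definition opnorm (X Y : normedModType K) (T : X -> Y) : K :=
  supremum 0 [set `|T x| | x in [set x : X | `|x| <= 1]].

Definition dual_space (X : normedModType K) : set {linear X -> K^o} :=
  @bounded_operator X K^o.

Definition unit_sphere (X : normedModType K) : set X := [set x | `|x| = 1].

Definition dual_unit_sphere (X : normedModType K) : set {linear X -> K^o} :=
  [set f | dual_space f /\ opnorm f = 1].

Definition numPi (X : normedModType K) : set (X * {linear X -> K^o}) :=
  [set p | [/\ unit_sphere p.1, dual_unit_sphere p.2 & p.2 p.1 = 1]].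

Definition numerical_radius (X : normedModType K) (T : X -> X) : K :=
  supremum 0 [set `|p.2 (T p.1)| | p in @numPi X].

Definition BPBp_nu (X : normedModType K) : Prop :=
  forall eps : K, 0 < eps < 1 ->
  exists2 eta : K, 0 < eta &
  forall (T : {linear X -> X}) (x : X) (xs : {linear X -> K^o}),
    bounded_operator T -> numPi (x, xs) ->
    numerical_radius T = 1 -> 1 - eta < `|xs (T x)| ->
  exists (S : {linear X -> X}) (y : X) (ys : {linear X -> K^o}),
    [/\ bounded_operator S, numPi (y, ys),
        numerical_radius S = 1 & `|ys (S y)| = 1] /\
    [/\ opnorm (T \- S) < eps, `|x - y| < eps & opnorm (xs \- ys) < eps].

End numerical_radius.

(* Main.v *)
Require Import Defs.
From HB Require Import structures.
From mathcomp Require Import all_boot all_order all_algebra.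
From mathcomp Require Import complex.
From mathcomp Require Import all_classical all_reals all_analysis.
Import numFieldNormedType.Exports.
Import Order.TTheory GRing.Theory Num.Theory.
Local Open Scope classical_set_scope.
Local Open Scope ring_scope.
Local Open Scope complex_scope.

(** The numerical radius v is a seminorm on the operators of X, and it need not
be a norm: v vanishes on the rotations of the real Euclidean plane by a right
angle. So the operators with v(T) = 1 can form an unbounded set, and the usual
compactness argument has to be run modulo the kernel of v.

Suppose that the property fails for some eps. Then there are T_k and
(x_k, f_k) in Pi(X) with v(T_k) = 1 and |f_k (T_k x_k)| > 1 - 1/(k+1) that
admit no approximation within eps. In finite dimension every operator T is
congruent, modulo the kernel of v, to an operator of norm at most C v(T)
(bounded_representative); let B_k be such a representative of T_k. Along a
nonprincipal ultrafilter on nat the bounded sequences B_k, x_k, f_k converge,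
to B, y, g say. Put

    S_k = T_k - B_k + B.

As v(T_k - B_k) = 0, subtracting T_k - B_k changes neither v nor any value
f (T x) with (x, f) in Pi(X). Hence v(S_k) = v(B) = lim v(B_k) = 1 and
|g (S_k y)| = |g (B y)| = lim |f_k (B_k x_k)| = lim |f_k (T_k x_k)| = 1, while
T_k - S_k = B_k - B, x_k - y and f_k - g tend to 0: for suitable k the triple
(S_k, y, g) is an approximation within eps, a contradiction.

The representatives come from a maximal set J of matrix positions such that v
is a norm on the matrices supported by J: by maximality these matrices
represent all classes modulo the kernel (definite_complement), and on them v
dominates the entries, by compactness of a unit sphere (definite_coercive).
The same result, applied to the norm of X and to the dual norm, bounds the
coordinates of x_k and f_k.

The argument works at once for every field K of scalars in which bounded
sequences converge along ultrafilters, bounded sets of nonnegative elements have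
suprema and the sequence 1/(k+1) tends to 0; the last section checks these three
conditions for R and R[i]. Ultrafilters serve instead of subsequences because
one ultrafilter makes all the coordinates converge simultaneously. *)

Set Implicit Arguments.
Unset Strict Implicit.
Unset Printing Implicit Defensive.

(** * Conditions on the scalars *)

Definition ultralimits (K : numFieldType) : Prop :=
  forall (U : set_system nat) (u : nat -> K) (M : K), UltraFilter U ->
    (forall k, `|u k| <= M) ->
  exists l : K, forall e : K, 0 < e -> U [set k | `|l - u k| < e].

(** The restriction to nonnegative N lets the empty set in, whose supremum is the
default value 0: the set Pi(X) is empty when X is trivial. *)
Definition nonneg_suprema (K : numFieldType) : Prop :=
  forall (A : set K) (M : K), (forall x, A x -> 0 <= x) -> ubound A M ->
  ubound A (supremum 0 A) /\
  (forall N, 0 <= N -> ubound A N -> supremum 0 A <= N).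

Definition archimedean_scalars (K : numFieldType) : Prop :=
  forall e : K, 0 < e -> exists k : nat, k.+1%:R^-1 < e.

(** * Seminorms *)

Definition seminorm (K : numFieldType) (V : lmodType K) (p : V -> K) : Prop :=
  (forall a x, p (a *: x) = `|a| * p x) /\ (forall x y, p (x + y) <= p x + p y).

Section seminorm_theory.
Variables (K : numFieldType) (V : lmodType K) (p : V -> K).
Hypothesis hp : seminorm p.

Lemma seminorm0 : p 0 = 0.
Proof. by have := hp.1 0 0; rewrite scale0r normr0 mul0r. Qed.

Lemma seminormN x : p (- x) = p x.
Proof. by rewrite -scaleN1r hp.1 normrN1 mul1r. Qed.

Lemma seminorm_ge0 x : 0 <= p x.
Proof.
have := hp.2 x (- x); rewrite subrr seminorm0 seminormN -mulr2n.
by rewrite pmulrn_lge0.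
Qed.

Lemma seminorm_le_dist x y : `|p x - p y| <= p (x - y).
Proof.
have pr z : p z \is Num.real by exact: ger0_real (seminorm_ge0 z).
rewrite real_ler_norml ?rpredB//; apply/andP; split.
  rewrite lerNl opprB lerBlDr -[in leRHS]seminormN opprB.
  by have := hp.2 (y - x) x; rewrite subrK.
by rewrite lerBlDr; have := hp.2 (x - y) y; rewrite subrK.
Qed.

Lemma seminorm_eq_mod0 x y : p (x - y) = 0 -> p x = p y.
Proof.
move=> h; have := seminorm_le_dist x y.
by rewrite h normr_le0 subr_eq0 => /eqP.
Qed.

Lemma seminorm_sum (I : Type) (s : seq I) (P : pred I) (f : I -> V) :
  p (\sum_(i <- s | P i) f i) <= \sum_(i <- s | P i) p (f i).
Proof.
elim/big_ind2 : _ => [|x a y b xa yb|//]; first by rewrite seminorm0.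
by rewrite (le_trans (hp.2 _ _))// lerD.
Qed.

End seminorm_theory.

Lemma norm_seminorm (K : numFieldType) (V : lmodType K) (W : normedModType K)
  (f : {linear V -> W}) : seminorm (fun v => `|f v|).
Proof.
by split=> [a x|x y]; rewrite ?linearZ ?normrZ// linearD ler_normD.
Qed.

(** * Entrywise convergence of matrices *)

Lemma cvg_sumr (K : numFieldType) (U : set_system nat) (FU : Filter U)
  (I : Type) (s : seq I) (f : I -> nat -> K) (l : I -> K) :
  (forall i, f i k @[k --> U] --> l i) ->
  \sum_(i <- s) f i k @[k --> U] --> \sum_(i <- s) l i.
Proof.
move=> fl; elim: s => [|i s ih].
  by under eq_fun do rewrite big_nil; rewrite big_nil; exact: cvg_cst.
by under eq_fun do rewrite big_cons; rewrite big_cons; exact: cvgD.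
Qed.

Lemma cvg_cst_eq (K : numFieldType) (U : set_system nat) (FU : ProperFilter U)
  (u : nat -> K) a l :
  (forall k, u k = a) -> u k @[k --> U] --> l -> l = a.
Proof.
move=> ua; have -> : u = fun=> a by exact/funext.
by move=> /cvg_unique; apply; [exact: norm_hausdorff|exact: cvg_cst].
Qed.

Section matrices.
Variables (K : numFieldType) (m n : nat).
Implicit Types (A B : 'M[K]_(m, n)).

Definition entrywise_cvg (U : set_system nat) (A : nat -> 'M[K]_(m, n))
    (L : 'M[K]_(m, n)) :=
  forall i j, A k i j @[k --> U] --> L i j.

Definition entry_sum A : K := \sum_i \sum_j `|A i j|.

Lemma entrywise_cvg_exists (U : set_system nat) (A : nat -> 'M[K]_(m, n)) M :
  ultralimits K -> UltraFilter U -> (forall k i j, `|A k i j| <= M) ->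
  exists L, entrywise_cvg U A L.
Proof.
move=> lim UU AM; have FU := @ultra_proper _ _ UU.
have h ij : exists l : K, A k ij.1 ij.2 @[k --> U] --> l.
  have [l hl] := lim U (fun k => A k ij.1 ij.2) M UU (fun k => AM k _ _).
  by exists l; apply/cvgrPdist_lt.
have [l hl] := choice h.
by exists (\matrix_(i, j) l (i, j)) => i j; rewrite mxE; exact: (hl (i, j)).
Qed.

Lemma entry_sum_seminorm : seminorm entry_sum.
Proof.
split=> [a A|A B]; rewrite /entry_sum.
  rewrite mulr_sumr; apply: eq_bigr => i _; rewrite mulr_sumr.
  by apply: eq_bigr => j _; rewrite mxE normrM.
rewrite -big_split ler_sum//= => i _; rewrite -big_split ler_sum//= => j _.
by rewrite mxE ler_normD.
Qed.

Lemma le_entry_sum A i j : `|A i j| <= entry_sum A.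
Proof.
rewrite /entry_sum (bigD1 i)//= (bigD1 j)//= -addrA lerDl addr_ge0//.
  by rewrite sumr_ge0.
by rewrite sumr_ge0// => k _; rewrite sumr_ge0.
Qed.

Variable p : 'M[K]_(m, n) -> K.
Hypothesis hp : seminorm p.

Lemma seminorm_le_entries A :
  p A <= \sum_i \sum_j `|A i j| * p (delta_mx i j).
Proof.
rewrite {1}(matrix_sum_delta A) (le_trans (seminorm_sum hp _ _ _))//.
rewrite ler_sum// => i _; rewrite (le_trans (seminorm_sum hp _ _ _))//.
by rewrite ler_sum// => j _; rewrite hp.1.
Qed.

(** Every seminorm is dominated by a weighted sum of the moduli of the entries,
so entrywise convergence implies convergence for any seminorm. *)
Lemma seminorm_cvg0 (U : set_system nat) (FU : Filter U)
  (A : nat -> 'M[K]_(m, n)) (L : 'M[K]_(m, n)) :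
  entrywise_cvg U A L -> p (A k - L) @[k --> U] --> (0 : K).
Proof.
move=> AL.
pose b k := \sum_i \sum_j `|(A k - L) i j| * p (delta_mx i j).
have b0 : b k @[k --> U] --> (0 : K).
  have <- : \sum_(i < m) \sum_(j < n) `|L i j - L i j| * p (delta_mx i j) = 0.
    by rewrite big1// => i _; rewrite big1// => j _; rewrite subrr normr0 mul0r.
  rewrite /b; apply: cvg_sumr => i; apply: cvg_sumr => j.
  under eq_fun do rewrite !mxE.
  by apply: cvgM; [apply: cvg_norm; apply: cvgB => //|]; exact: cvg_cst.
apply/cvgr0Pnorm_lt => e e0.
move/cvgr0Pnorm_lt : b0 => /(_ e e0); apply: filterS => k.
apply: le_lt_trans; rewrite ger0_norm ?seminorm_ge0//.
by rewrite (le_trans (seminorm_le_entries _))// real_ler_norm// ger0_real//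
  (le_trans (seminorm_ge0 hp _) (seminorm_le_entries _)).
Qed.

Lemma seminorm_cvg (U : set_system nat) (FU : Filter U)
  (A : nat -> 'M[K]_(m, n)) (L : 'M[K]_(m, n)) :
  entrywise_cvg U A L -> p (A k) @[k --> U] --> p L.
Proof.
move=> /(seminorm_cvg0 FU)/cvgr0Pnorm_lt h; apply/cvgrPdist_lt => e e0.
apply: filterS (h e e0) => k; apply: le_lt_trans.
by rewrite distrC (le_trans (seminorm_le_dist hp _ _))// real_ler_norm//
  ger0_real// seminorm_ge0.
Qed.

End matrices.

Lemma entrywise_cvg_mulmx (K : numFieldType) (m n q : nat) (U : set_system nat)
  (FU : Filter U) (A : nat -> 'M[K]_(m, n)) L (B : nat -> 'M[K]_(n, q)) M :
  entrywise_cvg U A L -> entrywise_cvg U B M ->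
  entrywise_cvg U (fun k => A k *m B k) (L *m M).
Proof.
move=> AL BM i j; under eq_fun do rewrite mxE; rewrite mxE.
by apply: cvg_sumr => l; apply: cvgM.
Qed.

(** * Bounded representatives modulo the kernel of a seminorm *)

Section coercivity.
Variables (K : numFieldType) (m n : nat) (p : 'M[K]_(m, n) -> K).
Hypothesis hp : seminorm p.
Implicit Types A B : 'M[K]_(m, n).

Definition supported (J : {set 'I_m * 'I_n}) A :=
  forall i j, (i, j) \notin J -> A i j = 0.

Definition definite_on (J : {set 'I_m * 'I_n}) :=
  forall A, supported J A -> p A = 0 -> A = 0.

Lemma supported_lin J a A B :
  supported J A -> supported J B -> supported J (a *: A + B).
Proof.
by move=> JA JB i j ij; rewrite !mxE JA// JB// mulr0 addr0.
Qed.

(** The set J is chosen maximal among those on which p is definite. If (i, j) is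
not in J, then p kills a nonzero D supported by J and (i, j); definiteness on J
forces D i j != 0, so the elementary matrix at (i, j) is congruent, modulo the
kernel of p, to a matrix supported by J. Linearity does the rest. *)
Lemma definite_complement : exists2 J, definite_on J &
  forall A, exists2 B, supported J B & p (A - B) = 0.
Proof.
pose P J := `[< definite_on J >].
have [|J Jmax] := @ex_maxset _ P.
  exists finset.set0; apply/asboolP => A A0 _; apply/matrixP => i j.
  by rewrite A0 ?inE// mxE.
have Jdef : definite_on J by exact/asboolP/(maxsetp Jmax).
exists J => //.
pose Q A := exists2 B, supported J B & p (A - B) = 0.
have Q0 : Q 0 by exists 0; rewrite ?subrr ?seminorm0// => i j; rewrite mxE.
have QL a A B : Q A -> Q B -> Q (a *: A + B).
  move=> [A' JA' pA] [B' JB' pB]; exists (a *: A' + B').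
    exact: supported_lin.
  apply/eqP; rewrite eq_le seminorm_ge0// andbT opprD addrACA -scalerBr.
  by rewrite (le_trans (hp.2 _ _))// hp.1 pA pB mulr0 addr0.
have Qd i j : Q (delta_mx i j).
  have [ijJ|ijJ] := boolP ((i, j) \in J).
    exists (delta_mx i j); last by rewrite subrr seminorm0.
    move=> i' j' ij'; rewrite mxE; case: eqP => //= -[ii]; case: eqP => //= jj.
    by move: ij'; rewrite ii jj ijJ.
  have : ~ definite_on ((i, j) |: J).
    move=> /asboolP/(maxsetsup Jmax) /(_ (finset.subsetUr _ _)) /setP /(_ (i, j)).
    by rewrite !inE eqxx (negbTE ijJ).
  move=> /existsNP [D /not_implyP [JD /not_implyP [pD D0]]].
  have Dij : D i j != 0.
    apply/eqP => Dij; apply: D0; apply: Jdef => // i' j' ij'.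
    have [[-> ->//]|ne] := eqVneq (i', j') (i, j).
    by rewrite JD// !inE negb_or ne.
  exists (delta_mx i j - (D i j)^-1 *: D).
    move=> i' j' ij'; rewrite !mxE.
    have [[-> ->]|ne] := eqVneq (i', j') (i, j).
      by rewrite !eqxx/= mulVf// subrr.
    rewrite (JD i' j') ?inE ?negb_or ?ne// mulr0 subr0.
    by move: ne; rewrite xpair_eqE => /negbTE ->.
  by rewrite opprB addrC subrK hp.1 pD mulr0.
move=> A; rewrite (matrix_sum_delta A).
have QD A' B' : Q A' -> Q B' -> Q (A' + B').
  by move=> qA qB; rewrite -(scale1r A'); exact: QL.
apply: (@big_ind _ Q) => // i _; apply: (@big_ind _ Q) => // j _.
by rewrite -[_ *: _]addr0; exact: QL.
Qed.

(** Otherwise there are matrices supported by J with entry sum 1 on which p tends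
to 0. Their limit along U has entry sum 1 and lies in the kernel of p, against
definiteness. *)
Lemma definite_coercive J (U : set_system nat) :
  ultralimits K -> archimedean_scalars K ->
  UltraFilter U -> \oo `<=` U -> definite_on J ->
  exists2 C, 0 <= C &
    forall A, supported J A -> forall i j, `|A i j| <= C * p A.
Proof.
move=> lim arch UU Uoo Jdef; have FU := @ultra_proper _ _ UU.
apply: contrapT => /forall2NP hC.
have {hC} h k : exists A,
    [/\ supported J A, entry_sum A = 1 & p A <= k.+1%:R^-1].
  case: (hC k.+1%:R) => [/negP|]; first by rewrite ler0n.
  move=> /existsNP [A /not_implyP [JA /existsNP [i /existsNP [j /negP]]]].
  rewrite -real_ltNge ?ger0_real ?mulr_ge0 ?(seminorm_ge0 hp)// => hA.
  have {hA} := lt_le_trans hA (le_entry_sum A i j).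
  set s := entry_sum A => hs.
  have s0 : 0 < s by rewrite (le_lt_trans _ hs)// mulr_ge0// seminorm_ge0.
  exists (s^-1 *: A); split.
  - by move=> i' j' /JA; rewrite mxE => ->; rewrite mulr0.
  - by rewrite (entry_sum_seminorm _ _ _).1 ger0_norm ?invr_ge0 ?ltW// mulVf ?gt_eqF.
  - rewrite hp.1 ger0_norm ?invr_ge0 ?(ltW s0)//.
    by rewrite ler_pdivrMl// mulrC ler_pdivlMl// ltW.
have [A hA] := choice h.
have [L AL] : exists L, entrywise_cvg U A L.
  apply: (@entrywise_cvg_exists _ _ _ U A 1) => // k i j.
  by have [_ <- _] := hA k; exact: le_entry_sum.
have L0 : p L = 0.
  apply: (@cvg_unique _ _ (p (A k) @[k --> U])); first exact: norm_hausdorff.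
    exact: seminorm_cvg.
  apply/cvgr0Pnorm_lt => e e0; have [N hN] := arch e e0.
  apply: Uoo; exists N => // k /= Nk; rewrite ger0_norm ?seminorm_ge0//.
  have [_ _ pA] := hA k.
  by rewrite (le_lt_trans pA)// (le_lt_trans _ hN)// lef_pV2 ?posrE// ler_nat.
have JL : supported J L.
  move=> i j ij; apply: (cvg_cst_eq FU _ (AL i j)) => k.
  by have [JA _ _] := hA k; exact: JA.
have : entry_sum L = 1.
  have := seminorm_cvg (@entry_sum_seminorm K m n) FU AL.
  by apply: cvg_cst_eq => k; have [_ ->] := hA k.
rewrite (Jdef L JL L0) seminorm0; last exact: entry_sum_seminorm.
by move=> /eqP; rewrite eq_sym oner_eq0.
Qed.

(** The distance to the kernel of p is controlled by p; if p is a norm, B = A and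
this is the comparison of p with the supremum norm of the entries. *)
Lemma bounded_representative (U : set_system nat) : ultralimits K ->
  archimedean_scalars K -> UltraFilter U -> \oo `<=` U ->
  exists2 C, 0 <= C & forall A, exists2 B, p (A - B) = 0 &
    forall i j, `|B i j| <= C * p A.
Proof.
move=> lim arch UU Uoo; have [J Jdef Jcompl] := definite_complement.
have [C C0 hC] := definite_coercive lim arch UU Uoo Jdef.
exists C => // A; have [B JB pAB] := Jcompl A; exists B => // i j.
by rewrite (seminorm_eq_mod0 hp pAB); exact: hC.
Qed.

End coercivity.

Lemma nonprincipal_ultrafilter :
  exists2 U : set_system nat, UltraFilter U & \oo `<=` U.
Proof.
by have [U [UU ooU]] := @ultraFilterLemma nat \oo _; exists U.
Qed.

(** * Seminorms defined by suprema *)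

(** Common pattern of the operator norm, of the dual norm (both with I = X and D
the unit ball) and of the numerical radius (with D = Pi(X)): the object v varies
in the linear space V, and it is tested against the points i of D. *)
Section supremum_seminorm.
Variables (K : numFieldType) (V : lmodType K) (W : normedModType K).
Variables (I : Type) (D : set I) (ell : I -> V -> W).
Hypothesis sup : nonneg_suprema K.
Hypothesis ell_lin : forall i, linear (ell i).
Hypothesis ell_bnd : forall v, exists M, forall i, D i -> `|ell i v| <= M.

Let p v := supremum 0 [set `|ell i v| | i in D].

Let supP v : ubound [set `|ell i v| | i in D] (p v) /\
  (forall N, 0 <= N -> ubound [set `|ell i v| | i in D] N -> p v <= N).
Proof.
have [M hM] := ell_bnd v.
by apply: (sup (M := M)) => _ [i Di <-]//; exact: hM.
Qed.

Lemma le_sup_seminorm i v : D i -> `|ell i v| <= p v.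
Proof. by move=> Di; apply: (supP v).1; exists i. Qed.

Lemma sup_seminorm_le v N : 0 <= N -> (forall i, D i -> `|ell i v| <= N) ->
  p v <= N.
Proof. by move=> N0 h; apply: (supP v).2 => // _ [i Di <-]; exact: h. Qed.

Lemma sup_seminorm_ge0 v : 0 <= p v.
Proof.
have [D0|/set0P[i Di]] := eqVneq D set0.
  by rewrite /p D0 image_set0 supremum0.
exact: le_trans (le_sup_seminorm v Di).
Qed.

Lemma sup_seminorm : seminorm p.
Proof.
have eZ i a v : ell i (a *: v) = a *: ell i v.
  have e0 : ell i 0 = 0.
    have := ell_lin i 1 0 0; rewrite scaler0 addr0 scale1r => /eqP.
    by rewrite -subr_eq0 opprD addNKr oppr_eq0 => /eqP.
  by have := ell_lin i a v 0; rewrite e0 !addr0.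
have pZ a v : p (a *: v) <= `|a| * p v.
  apply: sup_seminorm_le => [|i Di]; first by rewrite mulr_ge0 ?sup_seminorm_ge0.
  by rewrite eZ normrZ ler_wpM2l// le_sup_seminorm.
split=> [a v|v w].
  apply/eqP; rewrite eq_le pZ/=.
  have [->|a0] := eqVneq a 0; first by rewrite normr0 mul0r sup_seminorm_ge0.
  have := pZ a^-1 (a *: v); rewrite scalerA mulVf// scale1r normfV.
  by rewrite ler_pdivlMl ?normr_gt0.
apply: sup_seminorm_le => [|i Di]; first by rewrite addr_ge0 ?sup_seminorm_ge0.
rewrite -[v]scale1r ell_lin !scale1r (le_trans (ler_normD _ _))//.
by rewrite lerD// le_sup_seminorm.
Qed.

End supremum_seminorm.

(** * Operators and functionals in coordinates *)

Section coordinates.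
Variables (K : numFieldType) (X : normedModType K) (n : nat).
Variables (c : {linear X -> 'rV[K]_n}) (r : {linear 'rV[K]_n -> X}).
Hypotheses (cK : cancel c r) (rK : cancel r c).
Hypotheses (lim : ultralimits K) (arch : archimedean_scalars K).
Hypothesis sup : nonneg_suprema K.

Lemma coordinates_bounded : exists2 C, 0 <= C &
  forall x i, `|c x 0 i| <= C * `|x|.
Proof.
have [U UU ooU] := nonprincipal_ultrafilter.
have [C C0 hC] := bounded_representative (norm_seminorm r) lim arch UU ooU.
exists C => // x i; have [B + hB] := hC (c x).
rewrite linearB/= cK => /normr0_eq0/eqP; rewrite subr_eq0 => /eqP xB.
by have := hB 0 i; rewrite -(rK B) -xB cK.
Qed.

Lemma linear_bounded (W : normedModType K) (f : {linear X -> W}) :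
  exists2 M, 0 <= M & forall x, `|f x| <= M * `|x|.
Proof.
have [C C0 hC] := coordinates_bounded.
exists (\sum_(i < 1) \sum_(j < n) C * `|f (r (delta_mx i j))|).
  by rewrite sumr_ge0// => i _; rewrite sumr_ge0// => j _; rewrite mulr_ge0.
move=> x; rewrite -{1}(cK x).
rewrite (le_trans (seminorm_le_entries (norm_seminorm (f \o r)) (c x)))//.
rewrite mulr_suml ler_sum// => i _; rewrite mulr_suml ler_sum// => j _.
by rewrite mulrAC ler_wpM2r// (ord1 i).
Qed.

Lemma finite_dimensional_bounded (W : normedModType K) (f : {linear X -> W}) :
  bounded_operator f.
Proof.
have [M M0 hM] := linear_bounded f.
apply/linear_boundedP; near=> s => x; rewrite (le_trans (hM x))// ler_wpM2r//.
by near: s; apply: nbhs_pinfty_ge; exact: ger0_real.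
Unshelve. all: by end_near. Qed.

Definition operator_of (A : 'M[K]_n) : {linear X -> X} := r \o mulmxr A \o c.

Definition functional_of (a : 'cV[K]_n) (x : X) : K^o := (c x *m a) 0 0.

Lemma functional_of_linear a : linear (functional_of a).
Proof. by move=> k x y; rewrite /functional_of linearP mulmxDl -scalemxAl !mxE. Qed.

HB.instance Definition _ a := GRing.isLinear.Build K X K^o _ (functional_of a)
  (functional_of_linear a).

Lemma operator_ofP (T : {linear X -> X}) : exists A, T =1 operator_of A.
Proof.
by exists (lin1_mx (c \o T \o r)) => x; rewrite /= mul_rV_lin1/= !cK.
Qed.

Lemma functional_ofP (f : {linear X -> K^o}) : exists a, f =1 functional_of a.
Proof.
exists (\col_i f (r (delta_mx 0 i))) => x.
rewrite -{1}(cK x) {1}(row_sum_delta (c x)) !linear_sum/= /functional_of mxE.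
by apply: eq_bigr => i _; rewrite !linearZ mxE.
Qed.

Lemma le_opnorm (W : normedModType K) (f : {linear X -> W}) x :
  `|f x| <= opnorm f * `|x|.
Proof.
have [M M0 hM] := linear_bounded f.
have [ub _] : ubound [set `|f x| | x in [set x : X | `|x| <= 1]] (opnorm f) /\
  (forall N, 0 <= N -> ubound [set `|f x| | x in [set x : X | `|x| <= 1]] N ->
   opnorm f <= N).
  apply: (sup (M := M)) => _ [y /= y1 <-]//.
  by rewrite (le_trans (hM y))// ler_piMr.
have [->|x0] := eqVneq x 0; first by rewrite linear0 !normr0 mulr0.
have := ub `|f (`|x|^-1 *: x)|; rewrite linearZ normrZ normfV normr_id.
rewrite mulrC ler_pdivrMr ?normr_gt0//; apply.
exists (`|x|^-1 *: x); first by rewrite /= normrZ normfV normr_id mulVf ?normr_eq0.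
by rewrite linearZ normrZ normfV normr_id mulrC.
Qed.

Lemma opnorm_operator_seminorm : seminorm (fun A => opnorm (operator_of A)).
Proof.
apply: (@sup_seminorm K 'M[K]_n X X _ (fun x A => operator_of A x) sup).
  by move=> x a A B; rewrite /= mulmxDr -scalemxAr linearP.
move=> A; have [M M0 hM] := linear_bounded (operator_of A).
by exists M => x /= x1; rewrite (le_trans (hM x))// ler_piMr.
Qed.

Lemma opnorm_functional_seminorm : seminorm (fun a => opnorm (functional_of a)).
Proof.
apply: (@sup_seminorm K 'cV[K]_n K^o X _ (fun x a => functional_of a x) sup).
  by move=> x k a b; rewrite /functional_of mulmxDr -scalemxAr !mxE.
move=> a; have [M M0 hM] := linear_bounded (functional_of a).
by exists M => x /= x1; rewrite (le_trans (hM x))// ler_piMr.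
Qed.

Lemma opnorm_functional_eq0 a : opnorm (functional_of a) = 0 -> a = 0.
Proof.
move=> h; apply/matrixP => i j; rewrite (ord1 j) mxE.
have : `|functional_of a (r (delta_mx 0 i))| <= 0.
  by rewrite (le_trans (le_opnorm _ _))// h mul0r.
by rewrite normr_le0 /functional_of rK -rowE mxE => /eqP ->.
Qed.

Let num_bounded A : exists M, forall z, @numPi K X z ->
  `|z.2 (operator_of A z.1) : K^o| <= M.
Proof.
have [M M0 hM] := linear_bounded (operator_of A).
exists M => -[x f] [/= x1 [_ f1] _].
by rewrite (le_trans (le_opnorm f _))// f1 mul1r (le_trans (hM x))// x1 mulr1.
Qed.

Let num_linear (z : X * {linear X -> K^o}) :
  linear (fun A => z.2 (operator_of A z.1) : K^o).
Proof. by move=> a A B; rewrite /= mulmxDr -scalemxAr !linearP. Qed.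

Lemma numerical_radius_seminorm :
  seminorm (fun A => numerical_radius (operator_of A)).
Proof.
exact: (@sup_seminorm K _ K^o _ (@numPi K X)
  (fun z A => z.2 (operator_of A z.1)) sup num_linear num_bounded).
Qed.

Lemma le_numerical_radius A x f : numPi (x, f) ->
  `|f (operator_of A x)| <= numerical_radius (operator_of A).
Proof.
move=> xf; exact: (@le_sup_seminorm K _ K^o _ (@numPi K X)
  (fun z A => z.2 (operator_of A z.1)) sup num_bounded (x, f) A xf).
Qed.

Lemma functional_of_operator a A x :
  functional_of a (operator_of A x) = (c x *m A *m a) 0 0.
Proof. by rewrite /functional_of /= rK. Qed.

Lemma numPi_functional_of x (f : {linear X -> K^o}) a : f =1 functional_of a ->
  numPi (x, f) -> numPi (x, functional_of a : {linear X -> K^o}).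
Proof.
move=> /funext fa [/= x1 [_]]; rewrite fa => f1 fx.
by split=> //; split=> //; exact: finite_dimensional_bounded.
Qed.

(** * The compactness argument *)

(** The limits B' of the representatives, y and g of the pairs give the
approximations S_k = A_k - B_k + B', which stay close to A_k although the A_k
themselves may be unbounded. *)
Lemma BPBp_nu_coordinates : BPBp_nu X.
Proof.
move=> eps /andP[eps0 _]; apply: contrapT => /forall2NP noeta.
pose bad k (z : 'M[K]_n * X * 'cV[K]_n) := [/\
  numPi (z.1.2, functional_of z.2 : {linear X -> K^o}),
  numerical_radius (operator_of z.1.1) = 1,
  1 - k.+1%:R^-1 < `|functional_of z.2 (operator_of z.1.1 z.1.2)| &
  forall (S : {linear X -> X}) (y : X) (g : {linear X -> K^o}),
    [/\ bounded_operator S, numPi (y, g),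
      numerical_radius S = 1 & `|g (S y)| = 1] ->
    opnorm (operator_of z.1.1 \- S) < eps -> `|z.1.2 - y| < eps ->
    opnorm (functional_of z.2 \- g) < eps -> False].
have ex_bad k : exists z, bad k z.
  case: (noeta k.+1%:R^-1) => [/negP|]; first by rewrite invr_gt0 ltr0n.
  move=> /existsNP [T] /existsNP [x] /existsNP [f].
  move=> /not_implyP [_] /not_implyP [xf] /not_implyP [vT] /not_implyP [fTx no].
  have [A TA] := operator_ofP T; have [a fa] := functional_ofP f.
  have TAf := funext TA; have faf := funext fa.
  exists (A, x, a); split => /=.
  - exact: numPi_functional_of xf.
  - by rewrite -vT TAf.
  - by move: fTx; rewrite fa TA.
  - move=> S y g Sy TS xy fg; apply: no; exists S, y, g; split => //.
    by rewrite TAf faf.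
have [z hz] := choice ex_bad.
pose A k := (z k).1.1; pose x k := (z k).1.2; pose a k := (z k).2.
have [U UU ooU] := nonprincipal_ultrafilter.
have FU := @ultra_proper _ _ UU.
have zPi k : numPi (x k, functional_of (a k) : {linear X -> K^o}).
  by case: (hz k).
(* Each A k is replaced by a bounded B k, with the same tests by Pi(X). *)
have [C C0 hC] := bounded_representative numerical_radius_seminorm lim arch UU ooU.
have hB k : exists B, numerical_radius (operator_of (A k - B)) = 0 /\
    forall i j, `|B i j| <= C.
  have [B AB BC] := hC (A k); exists B; split=> // i j.
  by have := BC i j; have [_ -> _ _] := hz k; rewrite mulr1.
have {hC hB} [B hB] := choice hB.
have [B' BB'] : exists L, entrywise_cvg U B L.
  by apply: (entrywise_cvg_exists lim UU) => k i j; exact: (hB k).2.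
have [D D0 hD] := coordinates_bounded.
have [xi xxi] : exists L, entrywise_cvg U (fun k => c (x k)) L.
  apply: (@entrywise_cvg_exists _ _ _ U _ D lim UU) => k i j; rewrite (ord1 i).
  by rewrite (le_trans (hD _ _))//; have [/= -> _ _] := zPi k; rewrite mulr1.
have [E E0 hE] := bounded_representative opnorm_functional_seminorm lim arch UU ooU.
have [a' aa'] : exists L, entrywise_cvg U a L.
  apply: (@entrywise_cvg_exists _ _ _ U _ E lim UU) => k i j.
  have [b /opnorm_functional_eq0/eqP] := hE (a k); rewrite subr_eq0 => /eqP <-.
  by move=> /(_ i j); have [_ [_ /= ->] _] := zPi k; rewrite mulr1.
pose y := r xi; pose g : {linear X -> K^o} := functional_of a'.
have yg : numPi (y, g).
  split=> /=.
  - apply: (cvg_cst_eq FU _ (seminorm_cvg (norm_seminorm r) FU xxi)) => k.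
    by rewrite cK; have [] := zPi k.
  - split; first exact: finite_dimensional_bounded.
    apply: (cvg_cst_eq FU _ (seminorm_cvg opnorm_functional_seminorm FU aa')).
    by move=> k; have [_ []] := zPi k.
  - apply: (cvg_cst_eq FU _ (_ : (c (x k) *m a k) 0 0 @[k --> U] --> _)).
      by move=> k; have [_ _ <-] := zPi k.
    by rewrite /g /= /functional_of /y rK; exact: entrywise_cvg_mulmx.
have null A0 u f : numerical_radius (operator_of A0) = 0 -> numPi (u, f) ->
    f (operator_of A0 u) = 0.
  by move=> v0 /(le_numerical_radius A0); rewrite v0 normr_le0 => /eqP.
have vB k : numerical_radius (operator_of (B k)) = 1.
  have [_ <- _ _] := hz k.
  by rewrite (seminorm_eq_mod0 numerical_radius_seminorm (hB k).1).
have vB' : numerical_radius (operator_of B') = 1.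
  exact: (cvg_cst_eq FU vB (seminorm_cvg numerical_radius_seminorm FU BB')).
have opB A1 A2 u : operator_of (A1 + A2) u = operator_of A1 u + operator_of A2 u.
  by rewrite /= mulmxDr linearD.
have gB' : `|g (operator_of B' y)| = 1.
  have cv : functional_of (a k) (operator_of (A k) (x k)) @[k --> U] -->
      (functional_of a' (operator_of B' y) : K).
    have -> : (fun k => functional_of (a k) (operator_of (A k) (x k))) =
        (fun k => (c (x k) *m B k *m a k) 0 0).
      apply: funext => k; rewrite -[A k](subrK (B k)) opB linearD.
      rewrite (null _ _ _ (hB k).1 (zPi k)) add0r.
      exact: functional_of_operator.
    rewrite functional_of_operator /y rK.
    by apply: entrywise_cvg_mulmx => //; exact: entrywise_cvg_mulmx.
  apply: (@cvg_unique _ _ (`|functional_of (a k) (operator_of (A k) (x k))|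
    @[k --> U])); [exact: norm_hausdorff|exact: cvg_norm|].
  apply/cvgrPdist_lt => e e0; have [N hN] := arch e0.
  apply: ooU; exists N => // k /= Nk.
  have := le_numerical_radius (A k) (zPi k); have [_ -> lo _] := hz k.
  move=> hi; rewrite ger0_norm ?subr_ge0//.
  rewrite ltrBlDr -ltrBlDl; apply: le_lt_trans lo.
  rewrite lerD2l lerN2; apply: le_trans (ltW hN).
  by rewrite lef_pV2 ?posrE// ler_nat.
(* The three errors are null sequences along U, and U is proper. *)
have near1 : \forall k \near U, opnorm (operator_of (B k - B')) < eps.
  have /cvgr0Pnorm_lt/(_ eps eps0) := seminorm_cvg0 opnorm_operator_seminorm FU BB'.
  by apply: filterS => k; rewrite ger0_norm// (seminorm_ge0 opnorm_operator_seminorm).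
have near2 : \forall k \near U, `|x k - y| < eps.
  have /cvgr0Pnorm_lt/(_ eps eps0) := seminorm_cvg0 (norm_seminorm r) FU xxi.
  by apply: filterS => k; rewrite normr_id linearB cK.
have near3 : \forall k \near U, opnorm (functional_of (a k - a')) < eps.
  have /cvgr0Pnorm_lt/(_ eps eps0) := seminorm_cvg0 opnorm_functional_seminorm FU aa'.
  by apply: filterS => k; rewrite ger0_norm// (seminorm_ge0 opnorm_functional_seminorm).
have [k [k1 [k2 k3]]] := filter_ex (filterI near1 (filterI near2 near3)).
have [_ _ _ no] := hz k.
apply: (no (operator_of (A k - B k + B')) y g _ _ k2).
- split; [exact: finite_dimensional_bounded|exact: yg| |].
    rewrite -vB'; apply: (seminorm_eq_mod0 numerical_radius_seminorm).
    by rewrite addrK; exact: (hB k).1.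
  by rewrite opB linearD (null _ _ _ (hB k).1 yg) add0r.
- suff <- : operator_of (B k - B') =
      operator_of (A k) \- operator_of (A k - B k + B') :> (X -> X) by exact: k1.
  apply: funext => u /=; rewrite -linearB -mulmxBr /=.
  by rewrite opprD opprB addrA addrCA subrr addr0.
- suff <- : functional_of (a k - a') = functional_of (a k) \- g :> (X -> K^o).
    exact: k3.
  by apply: funext => u; rewrite /= /functional_of mulmxBr !mxE.
Qed.

End coordinates.

Lemma finite_dimensional_BPBp_nu (K : numFieldType) (X : normedModType K) :
  ultralimits K -> archimedean_scalars K -> nonneg_suprema K ->
  finite_dimensional X -> BPBp_nu X.
Proof.
move=> lim arch sup [n [c [clin [r cK rK]]]].
pose cl : {linear X -> 'rV[K]_n} := HB.pack c (GRing.isLinear.Build _ _ _ _ c clin).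
have rlin : linear r by exact: (@can2_linear _ _ _ cl r cK rK).
pose rl : {linear 'rV[K]_n -> X} := HB.pack r (GRing.isLinear.Build _ _ _ _ r rlin).
exact: (@BPBp_nu_coordinates K X n cl rl).
Qed.

(** * The real and the complex scalars *)

Section scalars.
Variable R : realType.

(** A cluster point of u along an ultrafilter is a limit: the ultrafilter decides
whether u is near l, and being far from l would exclude clustering at l. *)
Lemma real_ultralimits : ultralimits R.
Proof.
move=> U u M UU uM; have FU := @ultra_proper _ _ UU.
have UM : (u @ U) `[- M, M]%classic.
  by apply: (@filterE _ U) => k; rewrite /= in_itv /= -ler_norml; exact: uM.
have [l [_ ul]] := @segment_compact R (- M) M _ _ UM.
exists l => e e0; have [//|nU] := in_ultra_setVsetC [set k | `|l - u k| < e] UU.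
have far : (u @ U) [set y | e <= `|l - y|].
  by apply: (@filterS _ U _ _ _ _ nU) => k /= lk; rewrite leNgt; exact/negP.
have [y [/= ey]] := ul _ _ far (nbhsx_ballx l e e0).
by rewrite /ball /= ltNge ey.
Qed.

Lemma real_archimedean : archimedean_scalars R.
Proof.
by move=> e e0; have [k] := ltr_add_invr e0; rewrite add0r; exists k.
Qed.

Lemma supremumP (K : numFieldType) (A : set K) (M : K) : A !=set0 ->
  ubound A M -> lbound (ubound A) M -> supremum 0 A = M.
Proof.
move=> /set0P A0 ubM lbM; rewrite /supremum (negbTE A0).
by apply: (xget_unique 0) => // N NA; exact: (@is_subset1_supremums _ _ A).
Qed.

Lemma real_nonneg_suprema : nonneg_suprema R.
Proof.
move=> A M _ AM.
have [->|/set0P A0] := eqVneq A set0.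
  by rewrite supremum0; split => // x.
have hA : has_ubound A by exists M.
have -> : supremum 0 A = sup A.
  by apply: supremumP => // [x Ax|N]; [exact: ub_le_sup|exact: ge_sup].
by split=> [x Ax|N _]; [exact: ub_le_sup|exact: ge_sup].
Qed.

Local Notation Re := (@complex.Re R).
Local Notation Im := (@complex.Im R).

Lemma complex_norm_le (w : R[i]) : `|w| <= (`|Re w| + `|Im w|)%:C.
Proof.
rewrite normc_def lecR -[leRHS]ger0_norm ?addr_ge0// -sqrtr_sqr.
rewrite ler_wsqrtr// sqrrD !real_normK ?num_real// addrAC lerDl.
by rewrite mulrn_wge0// mulr_ge0.
Qed.

Lemma complex_norm_ge_Im (w : R[i]) : `|Im w|%:C <= `|w|.
Proof. by rewrite normc_def lecR -sqrtr_sqr ler_wsqrtr// lerDr sqr_ge0. Qed.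

Lemma complex_ultralimits : ultralimits R[i].
Proof.
move=> U u M UU uM; have FU := @ultra_proper _ _ UU.
have M0 : 0 <= M by rewrite (le_trans _ (uM 0%N)).
have ReM k : `|Re (u k)| <= Re M.
  by have := le_trans (normc_ge_Re (u k)) (uM k); rewrite lecE => /andP[].
have ImM k : `|Im (u k)| <= Re M.
  by have := le_trans (complex_norm_ge_Im (u k)) (uM k); rewrite lecE => /andP[].
have [a ha] := real_ultralimits UU ReM.
have [b hb] := real_ultralimits UU ImM.
exists (a +i* b) => e e0.
have e0' : 0 < Re e / 2 by move: e0; rewrite ltcE => /andP[_ ?]; rewrite divr_gt0.
have eE : e = (Re e)%:C by rewrite RRe_real// gtr0_real.
apply: filterS (filterI (ha _ e0') (hb _ e0')) => k /= [hak hbk].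
rewrite (le_lt_trans (complex_norm_le _))// eE ltcR [ltRHS]splitr.
by move: hak hbk; case: (u k) => c d /=; exact: ltrD.
Qed.

Lemma complex_archimedean : archimedean_scalars R[i].
Proof.
move=> e e0; have eE : e = (Re e)%:C by rewrite RRe_real// gtr0_real.
have e0' : 0 < Re e by move: e0; rewrite ltcE => /andP[].
have [k hk] := real_archimedean e0'; exists k.
by rewrite eE -(rmorph_nat (real_complex R)) -fmorphV ltcR.
Qed.

(** Nonnegative complex numbers are real, so the supremum of A is that of its real
parts; an upper bound of a nonempty A is itself nonnegative, hence real. *)
Lemma complex_nonneg_suprema : nonneg_suprema R[i].
Proof.
move=> A M A0 AM.
have [->|/set0P An] := eqVneq A set0.
  by rewrite supremum0; split => // x.
pose B := Re @` A.
have BN N : ubound A N -> ubound B (Re N).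
  by move=> AN _ [x Ax <-]; have := AN x Ax; rewrite lecE => /andP[].
have hB : has_ubound B by exists (Re M); exact: BN.
have Bn : B !=set0 by case: An => x Ax; exists (Re x); exists x.
have ub : ubound A (sup B)%:C.
  move=> x Ax; rewrite -(RRe_real (ger0_real (A0 x Ax))) lecR.
  by apply: ub_le_sup => //; exists x.
have lb : lbound (ubound A) (sup B)%:C.
  move=> N AN; have [x Ax] := An.
  have N0 : 0 <= N by rewrite (le_trans (A0 x Ax))// AN.
  by rewrite -(RRe_real (ger0_real N0)) lecR; apply: ge_sup => //; exact: BN.
by rewrite (supremumP An ub lb); split=> // N _; exact: lb.
Qed.

End scalars.

Theorem proposition2p2 (R : realType) :
  (forall X : completeNormedModType R,
     finite_dimensional X -> BPBp_nu X) /\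
  (forall X : completeNormedModType R[i],
     finite_dimensional X -> BPBp_nu X).
Proof.
split=> X; apply: finite_dimensional_BPBp_nu.
- exact: real_ultralimits.
- exact: real_archimedean.
- exact: real_nonneg_suprema.
- exact: complex_ultralimits.
- exact: complex_archimedean.
- exact: complex_nonneg_suprema.
Qed.
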